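(* Let $R=\bigoplus_{i\ge 0}R_i$ be a standard graded algebra over a field $\mathbb{K}$, with Hilbert function $h_i=\dim_{\mathbb{K}}R_i$ for all $i\ge 0$. Let $r\ge 1$ be an integer. Let $x\ge r-1$ be the unique real number satisfying $h_r=\binom{x}{r}$. Then $$h_{r-1}\ \ge\ \binom{x-1}{r-1}\quad\text{and}\quad h_{r+1}\ \le\ \binom{x+1}{r+1}.$$
   Context: A standard graded algebra over a field $\mathbb{K}$ is a commutative $\mathbb{K}$-algebra $R$ with a vector space decomposition $R=\bigoplus_{i\ge 0}R_i$ such that $R_0=\mathbb{K}$, $R_iR_j\subseteq R_{i+j}$ for all $i,j\ge 0$, and $R$ is generated as a $\mathbb{K}$-algebra by finitely many elements of $R_1$ (so each $R_i$ is finite-dimensional). For $x\in\mathbb{R}$ and an integer $i\ge 1$, $\binom{x}{i}=\frac{x(x-1)\cdots(x-i+1)}{i!}$, and $\binom{x}{0}=1$. For $i\ge1$, the map $x\mapsto\binom{x}{i}$ is an increasing bijection from the real interval $[i-1,\infty)$ onto $[0,\infty)$. *)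

(* Defs.v *)
From HB Require Import structures.
From mathcomp Require Import all_boot all_order all_algebra.
From mathcomp Require Import boolp classical_sets reals.

Set Implicit Arguments.
Unset Strict Implicit.
Unset Printing Implicit Defensive.

Import Order.TTheory GRing.Theory Num.Theory.

Local Open Scope ring_scope.

Definition is_basis (K : fieldType) (V : lmodType K) (A : set V)
    (n : nat) (e : 'I_n -> V) : Prop :=
  [/\ forall i, A (e i),
      forall c : 'I_n -> K, \sum_(i < n) c i *: e i = 0 -> forall i, c i = 0
    & forall v, A v -> exists c : 'I_n -> K, v = \sum_(i < n) c i *: e i].

(* The ambient space need not be finite-dimensional, so [\dim] on [{vspace V}]
   is not available.  The value is 0 if [A] has no finite basis. *)
Definition dimension (K : fieldType) (V : lmodType K) (A : set V) : nat :=
  xget 0%N [set n | exists e : 'I_n -> V, is_basis A e].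

(* [mem S] is the boolean predicate that [submod_closed] and [subalg_closed]
   expect; [x \in mem S] is equivalent to [S x] by [in_setE]. *)
Record standard_graded (K : fieldType) (R : comAlgType K)
    (A : nat -> set R) : Prop := StandardGraded {
  graded_submod : forall i, submod_closed (mem (A i));
  graded_span : forall x : R, exists (n : nat) (f : nat -> R),
    (forall i, A i (f i)) /\ x = \sum_(i < n) f i;
  graded_direct : forall (n : nat) (f : nat -> R),
    (forall i, A i (f i)) -> \sum_(i < n) f i = 0 ->
    forall i, (i < n)%N -> f i = 0;
  (* [R] is nontrivial, so [a |-> a%:A] is injective and its range is a copy
     of [K]. *)
  graded0 : A 0%N = range (fun a : K => a%:A);
  gradedM : forall i j x y, A i x -> A j y -> A (i + j)%N (x * y);
  (* [R] is the only subalgebra containing the generators [s]. *)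
  graded_gen : exists s : seq R, (forall x, x \in s -> A 1%N x) /\
    forall S : set R, subalg_closed (mem S) ->
      (forall x, x \in s -> S x) -> S = setT
}.

Definition hilbert_function (K : fieldType) (R : comAlgType K)
    (A : nat -> set R) (i : nat) : nat := dimension (A i).

Definition gbinomial (F : realType) (x : F) (i : nat) : F :=
  (\prod_(j < i) (x - j%:R)) / i`!%:R.

(* Main.v *)
Require Import Defs.
From HB Require Import structures.
From mathcomp Require Import all_boot all_order all_algebra.
From mathcomp Require Import boolp classical_sets reals.
From mathcomp Require Import ring zify.

Set Implicit Arguments.
Unset Strict Implicit.
Unset Printing Implicit Defensive.

Import Order.TTheory GRing.Theory Num.Theory.

Local Open Scope ring_scope.

(* Order the monomials of bounded degree in the generators compatibly with
   multiplication.  The monomials that are not linear combinations of smaller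
   ones of the same degree form bases of the graded pieces, and they are closed
   under division by variables.  The upper bound thus becomes: if N is a set of
   monomials of degree r+1 all of whose quotients by a variable lie in a set M
   of binom(x,r) monomials of degree r, then |N| <= binom(x+1,r+1).

   Let D v and E v be the total exponents of the variable v in M and in N.
   Since the E v add up to (r+1)|N|, the D v to r|M|, and
   binom(x+1,r+1) = (x+1)/(r+1) binom(x,r), it is enough that
   E v <= (x+1)/r D v for every v.  Dividing by v gives E v <= |M| + D v, which
   suffices when D v >= binom(x,r-1).  Otherwise, apply induction on r to the
   sets of monomials t^k m with v^(k+1) m in M or N, where t is a new variable:
   they have D v and E v elements.

   The lower bound for h_(r-1) is the upper bound in degree r-1, read backwards
   through the monotonicity of binom(x,r) in x. *)

(** * Binomial coefficients with a real upper argument *)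

Section Gbinomial.
Variable F : realType.
Implicit Types (x y c : F) (r : nat).

Lemma gbinomial0 x : gbinomial x 0 = 1.
Proof. by rewrite /gbinomial big_ord0 fact0 divr1. Qed.

Lemma gbinomialS x r :
  gbinomial x r.+1 = (x - r%:R) / r.+1%:R * gbinomial x r.
Proof.
by rewrite /gbinomial big_ord_recr factS natrM invfM /= [X in X * _]mulrC mulrACA.
Qed.

Lemma gbinomialD1 x r :
  gbinomial (x + 1) r.+1 = (x + 1) / r.+1%:R * gbinomial x r.
Proof.
rewrite /gbinomial big_ord_recl factS natrM invfM /= subr0 mulrACA.
congr (_ * (_ * _)); apply: eq_bigr => j _.
by rewrite /bump /= natrD opprD addrA addrK.
Qed.

Lemma gbinomial_ge1 x r : r%:R <= x -> 1 <= gbinomial x r.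
Proof.
elim: r x => [|r IHr] x hx; first by rewrite gbinomial0.
rewrite -(subrK 1 x) gbinomialD1 subrK -[leLHS]mulr1 ler_pM //.
  by rewrite ler_pdivlMr ?mul1r.
by apply: IHr; rewrite lerBrDr natr1.
Qed.

Lemma gbinomial_ge0 x r : r%:R - 1 <= x -> 0 <= gbinomial x r.
Proof.
case: r => [|r] hx; first by rewrite gbinomial0.
have {}hx : r%:R <= x by move: hx; rewrite -natr1 addrK.
rewrite gbinomialS; apply: mulr_ge0; last exact: le_trans ler01 (gbinomial_ge1 hx).
by rewrite divr_ge0 ?subr_ge0.
Qed.

Lemma ltr_gbinomial x y r :
  r%:R <= x -> x < y -> gbinomial x r.+1 < gbinomial y r.+1.
Proof.
elim: r x y => [|r IHr] x y hx xy.
  by rewrite !gbinomialS !gbinomial0 !mulr1 !subr0 !divr1.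
have hy := le_trans hx (ltW xy).
rewrite !(gbinomialS _ r.+1); apply: ltr_pM.
- by rewrite divr_ge0 ?subr_ge0.
- by rewrite gbinomial_ge0// -natr1 addrK; apply: le_trans hx; rewrite ler_nat.
- by rewrite ltr_pM2r ?invr_gt0 ?ltr0n// ltrD2r.
- by apply: IHr => //; apply: le_trans hx; rewrite ler_nat.
Qed.

Lemma ler_gbinomial x y r :
  r%:R <= x -> x <= y -> gbinomial x r.+1 <= gbinomial y r.+1.
Proof.
by move=> hx; rewrite le_eqVlt => /predU1P[->//|/(ltr_gbinomial hx)/ltW].
Qed.

Lemma gbinomial_surj c r :
  0 <= c -> exists2 x, r%:R <= x & gbinomial x r.+1 = c.
Proof.
move=> c0.
pose p : {poly F} := (r.+1`!%:R)^-1 *: \prod_(j < r.+1) ('X - (j%:R)%:P) - c%:P.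
have pE x : p.[x] = gbinomial x r.+1 - c.
  rewrite /p hornerD hornerN hornerZ hornerC horner_prod /gbinomial mulrC.
  by congr (_ / _ - _); apply: eq_bigr => j _; rewrite hornerXsubC.
(* At [r] the value is 0. At this right end the first factor in [gbinomialS] is [c] and the other is
   at least 1. *)
have rb : r%:R <= r%:R + c * r.+1%:R :> F by rewrite lerDl mulr_ge0.
have [|x /andP[rx _]] := @poly_ivt F p _ _ rb.
- rewrite !pE; apply/andP; split.
    by rewrite gbinomialS subrr !mul0r sub0r oppr_le0.
  rewrite subr_ge0 gbinomialS addrC addKr mulfK ?pnatr_eq0//.
  by rewrite ler_peMr// gbinomial_ge1.
by rewrite rootE pE subr_eq0 => /eqP; exists x.
Qed.

End Gbinomial.

(** * Shadows of sets of monomials *)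

Section Monomials.
Variable V : finType.
Implicit Types (m : {ffun V -> nat}) (v w : V) (k : nat).
Implicit Types M N : seq {ffun V -> nat}.

Definition mdeg m := (\sum_v m v)%N.

Definition divX m v := [ffun w => (m w - (w == v))%N].

Definition mulX m v := [ffun w => (m w + (w == v))%N].

Definition shadow_in N M :=
  forall m v, m \in N -> (0 < m v)%N -> divX m v \in M.

(* For [k < m v] this is [m / v ^ (k+1)] times the [k]-th power of a new
   variable [None], so that [polarization v M] has as many elements as the
   total exponent of [v] in [M]. *)
Definition polar v m k : {ffun option V -> nat} :=
  [ffun o => if o is Some w then (m w - (w == v) * k.+1)%N else k].

Definition polarization v M := [seq polar v m k | m <- M, k <- iota 0 (m v)].

Lemma divXK m v : (0 < m v)%N -> mulX (divX m v) v = m.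
Proof. by move=> mv; apply/ffunP => w; rewrite !ffunE; case: eqP => [->|] /=; lia. Qed.

Lemma mdeg_mulX m v : mdeg (mulX m v) = (mdeg m).+1.
Proof.
rewrite /mdeg; under eq_bigr do rewrite ffunE.
by rewrite big_split/= -[in LHS]big_mkcond/= big_pred1_eq addn1.
Qed.

Lemma mdeg_divX m v : (0 < m v)%N -> mdeg m = (mdeg (divX m v)).+1.
Proof. by move=> mv; rewrite -(mdeg_mulX _ v) divXK. Qed.

Lemma mdeg_gt0 m : (0 < mdeg m)%N -> exists v, (0 < m v)%N.
Proof.
by rewrite lt0n sum_nat_eq0 => /forallPn[v]; rewrite -lt0n; exists v.
Qed.

Lemma polarizationP v M p :
  reflect (exists m k, [/\ m \in M, (k < m v)%N & p = polar v m k])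
          (p \in polarization v M).
Proof.
apply: (iffP allpairsPdep) => -[m [k [mM kv ->]]]; exists m, k.
  by move: kv; rewrite mem_iota.
by rewrite mem_iota.
Qed.

Lemma size_polarization v M : size (polarization v M) = \sum_(m <- M) m v.
Proof.
rewrite size_allpairs_dep sumnE big_map.
by apply: eq_bigr => m _; rewrite size_iota.
Qed.

Lemma polar_inj v m m' k k' : (k < m v)%N -> (k' < m' v)%N ->
  polar v m k = polar v m' k' -> m = m' /\ k = k'.
Proof.
move=> kv kv' /ffunP E; have := E None; rewrite !ffunE => kk'; split=> //.
subst k'; apply/ffunP => w; have := E (Some w); rewrite !ffunE.
by case: eqP => [->|]; lia.
Qed.

Lemma uniq_polarization v M : uniq M -> uniq (polarization v M).
Proof.
move=> uM; apply: allpairs_uniq_dep => // [m _|]; first exact: iota_uniq.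
move=> _ _ /allpairsPdep[m [k [_ + ->]]] /allpairsPdep[m' [k' [_ + ->]]].
by rewrite !mem_iota /= !add0n => kv kv' /(polar_inj kv kv')[-> ->].
Qed.

Lemma sum_mdeg d M :
  (forall m, m \in M -> mdeg m = d) -> (\sum_v \sum_(m <- M) m v = d * size M)%N.
Proof.
move=> Md; rewrite exchange_big/= (eq_big_seq (fun=> d)) => [|m /Md <-//].
by rewrite big_const_seq count_predT iter_addn addn0.
Qed.

(* Division by [v] injects the multiples of [v] in [N] into [M]. *)
Lemma sum_exponent_le v M N :
  uniq M -> uniq N -> shadow_in N M ->
  (\sum_(m <- N) m v <= size M + \sum_(m <- M) m v)%N.
Proof.
move=> uM uN NM; rewrite (bigID (fun m : {ffun V -> nat} => 0 < m v))%N/=.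
rewrite [X in (_ + X)%N]big1 ?addn0 => [|m]; last by lia.
rewrite -big_filter.
pose N' := [seq divX m v | m <- N & (0 < m v)%N].
apply: (@leq_trans (\sum_(m <- N') (m v).+1)%N).
  rewrite big_map; rewrite !big_filter; apply: leq_sum => m m0.
  by rewrite ffunE eqxx; lia.
have uN' : uniq N'.
  rewrite map_inj_in_uniq ?filter_uniq// => m m'; rewrite !mem_filter.
  by move=> /andP[m0 _] /andP[m'0 _] /(congr1 (mulX^~ v)); rewrite !divXK.
have sN' : {subset N' <= M}.
  by move=> _ /mapP[m + ->]; rewrite mem_filter => /andP[m0 mN]; apply: NM.
have -> : (size M + \sum_(m <- M) m v = \sum_(m <- M) (m v).+1)%N.
  under [RHS]eq_bigr do rewrite -add1n.
  by rewrite big_split/= sum1_size.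
rewrite [leqRHS](bigID (mem N'))/= -[X in (_ <= X + _)%N]big_filter.
rewrite (perm_big [seq m <- M | m \in N']) ?leq_addr//.
apply: uniq_perm => //; first exact: filter_uniq.
by move=> m; rewrite mem_filter; apply/idP/andP => [mN|[]//]; split=> //; apply: sN'.
Qed.

Lemma shadow_bound_step r (F : realType) M N (x : F) :
  uniq M -> uniq N ->
  (forall m, m \in M -> mdeg m = r.+1) -> (forall m, m \in N -> mdeg m = r.+2) ->
  shadow_in N M -> r%:R <= x -> (size M)%:R = gbinomial x r.+1 ->
  (forall v, (\sum_(m <- M) m v)%:R < gbinomial x r ->
     (\sum_(m <- N) m v)%:R <= (x + 1) / r.+1%:R * (\sum_(m <- M) m v)%:R) ->
  (size N)%:R <= gbinomial (x + 1) r.+2.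
Proof.
move=> uM uN dM dN NM hx sM small.
have claim v :
    (\sum_(m <- N) m v)%:R <= (x + 1) / r.+1%:R * (\sum_(m <- M) m v)%:R.
  have [Dx|/small//] := lerP (gbinomial x r) (\sum_(m <- M) m v)%:R.
  have := sum_exponent_le v uM uN NM; rewrite -(ler_nat F) natrD sM.
  move=> /le_trans; apply.
  (* Since |M| = (x-r)/(r+1) binom(x,r), the case assumption [Dx] gives |M| + D v <= ((x-r)/(r+1) +
     1) D v. *)
  have -> : x + 1 = (x - r%:R) + r.+1%:R by rewrite -natr1; ring.
  rewrite gbinomialS [in leRHS]mulrDl divff ?pnatr_eq0// [in leRHS]mulrDl mul1r.
  rewrite lerD2r.
  by apply: ler_wpM2l => //; rewrite divr_ge0 ?subr_ge0.
have : \sum_v (\sum_(m <- N) m v)%:R <=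
    \sum_v (x + 1) / r.+1%:R * (\sum_(m <- M) m v)%:R.
  by apply: ler_sum => v _; apply: claim.
rewrite -mulr_sumr -!natr_sum (sum_mdeg dM) (sum_mdeg dN) !natrM.
rewrite mulrA divfK ?pnatr_eq0// sM gbinomialD1 => NM'.
by rewrite mulrAC ler_pdivlMr ?ltr0n// mulrC.
Qed.

End Monomials.

(** The monomial trades [k.+1] factors [v] for [k] factors [None]. *)
Lemma mdeg_polar (V : finType) (v : V) (m : {ffun V -> nat}) k :
  (k < m v)%N -> (mdeg (polar v m k)).+1 = mdeg m.
Proof.
move=> kv; rewrite /mdeg (bigD1 None)//= ffunE.
rewrite (reindex_omap Some id) => [|[]]//=.
transitivity (\sum_w ((m w - (w == v) * k.+1) + (if w == v then k.+1 else 0)))%N.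
  rewrite big_split/= -big_mkcond/= big_pred1_eq addnS addnC; congr (_ + _).+1%N.
  by apply: eq_big => [w|w _]; rewrite ?eqxx// ffunE.
by apply: eq_bigr => w _; case: eqP => [->|_]; lia.
Qed.

(** Dividing [polar v m k] by an old variable [w] gives [polar v (divX m w) k]; dividing it by the
    new variable gives [polar v (divX m v) k.-1]. *)
Lemma shadow_polarization (V : finType) (v : V) N M :
  shadow_in N M -> shadow_in (polarization v N) (polarization v M).
Proof.
move=> NM _ o /polarizationP[m [k [mN kv ->]]]; rewrite ffunE.
case: o => [w|] /= o0; apply/polarizationP.
  exists (divX m w), k; split.
  - by apply: NM => //; apply: leq_trans o0 (leq_subr _ _).
  - by rewrite ffunE; move: o0; case: (eqVneq w v) => [->|] /=; rewrite ?eqxx; lia.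
  - by apply/ffunP => -[u|]; rewrite !ffunE/= ?ffunE; [rewrite subnAC|rewrite subn0].
exists (divX m v), k.-1; split.
- by apply: NM => //; lia.
- by rewrite ffunE eqxx; lia.
- by apply/ffunP => -[u|]; rewrite !ffunE/= ?ffunE; [case: (u =P v) => /=; lia|lia].
Qed.

(** The induction ranges over all [V], because polarization adds a variable while lowering degrees
    by one. *)
Lemma shadow_bound (F : realType) r (V : finType) (M N : seq {ffun V -> nat}) (x : F) :
  uniq M -> uniq N ->
  (forall m, m \in M -> mdeg m = r.+1) -> (forall m, m \in N -> mdeg m = r.+2) ->
  shadow_in N M -> r%:R <= x -> (size M)%:R = gbinomial x r.+1 ->
  (size N)%:R <= gbinomial (x + 1) r.+2.
Proof.
elim: r V M N x => [|r IHr] V M N x uM uN dM dN NM hx sM;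
  apply: (shadow_bound_step uM uN dM dN NM hx sM) => v;
  have := @shadow_polarization _ v _ _ NM;
  rewrite -!size_polarization => NM'.
  (* Here D v < 1, so [polarization v M] is empty. The members of [polarization v N] have degree 1,
     so each would have a quotient in that empty set. *)
  rewrite gbinomial0 ltrn1 ltnS leqn0 => /nilP M0.
  suff -> : polarization v N = [::] by rewrite M0 mulr0.
  rewrite M0 in NM' *; case E: (polarization v N) NM' => [//|p s] NM'.
  have /polarizationP[m [k [mN kv pE]]] : p \in polarization v N.
    by rewrite E mem_head.
  have [|w pw] := @mdeg_gt0 _ p.
    by have := mdeg_polar kv; rewrite -pE (dN _ mN) => -[->].
  by have := NM' p w (mem_head _ _) pw.
(* With D v = binom(y,r+1), the induction hypothesis gives E v <= binom(y+1,r+2) = (y+1)/(r+2) D v,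
   and y <= x because D v < binom(x,r+1). *)
move=> Dx; have [y ry yD] := @gbinomial_surj F _ r (ler0n _ (size (polarization v M))).
have yx : y <= x.
  rewrite leNgt; apply/negP => xy; move: Dx; rewrite -yD ltNge.
  by rewrite ler_gbinomial ?(ltW xy)// (le_trans _ hx)// ler_nat.
have uM' := uniq_polarization v uM; have uN' := uniq_polarization v uN.
apply: le_trans (IHr _ _ _ y uM' uN' _ _ NM' ry (esym yD)) _.
- by move=> _ /polarizationP[m [k [/dM + kv ->]]]; rewrite -(mdeg_polar kv) => -[].
- by move=> _ /polarizationP[m [k [/dN + kv ->]]]; rewrite -(mdeg_polar kv) => -[].
rewrite gbinomialD1 yD; apply: ler_wpM2r => //.
by rewrite ler_pM2r ?invr_gt0 ?ltr0n// lerD2r.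
Qed.

(** * Bases and spans *)

Section LinearAlgebra.
Variables (K : fieldType) (V : lmodType K).
Implicit Types (A P S : set V).

(** Expressing each family in the other gives coordinate matrices whose product is the identity of
    size [n], by freeness of [e]; this forces [n <= p]. *)
Lemma basis_size_le A n p (e : 'I_n -> V) (f : 'I_p -> V) :
  is_basis A e -> is_basis A f -> (n <= p)%N.
Proof.
move=> [eA efree espan] [fA _ fspan].
have [P eP] := choice (fun i => fspan _ (eA i)).
have [Q fQ] := choice (fun j => espan _ (fA j)).
apply: (@mulmx1_min K _ _ (\matrix_(i, j) P i j) (\matrix_(j, i) Q j i)).
apply/matrixP => i k; rewrite !mxE; apply/eqP; rewrite -subr_eq0; apply/eqP.
under eq_bigr do rewrite !mxE.
apply: (efree (fun k => \sum_j P i j * Q j k - (i == k)%:R)).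
under eq_bigr do rewrite scalerBl scaler_suml.
rewrite sumrB exchange_big/= [X in _ - X](bigD1 i)//= eqxx scale1r.
rewrite [X in _ - (_ + X)]big1 => [|l /negPf]; last first.
  by rewrite eq_sym => ->; rewrite scale0r.
rewrite addr0 eP -sumrB big1// => j _; rewrite fQ scaler_sumr.
by rewrite -sumrB big1// => l _; rewrite scalerA subrr.
Qed.

Lemma dimensionE A n (e : 'I_n -> V) : is_basis A e -> dimension A = n.
Proof.
move=> be; rewrite /dimension.
have [f bf] := xgetPex 0%N (ex_intro (fun n => exists e : 'I_n -> V, is_basis A e) n
  (ex_intro _ e be)).
by apply/eqP; rewrite eqn_leq (basis_size_le bf be) (basis_size_le be bf).
Qed.

(** Defined as an intersection of subspaces, so that a linear property true on [P] passes to the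
    span by mere application, with no coefficients to handle. *)
Definition linspan P : set V := fun y => forall S,
  S 0 -> (forall a u v, S u -> S v -> S (a *: u + v)) ->
  (forall x, P x -> S x) -> S y.

Lemma linspan_sub P x : P x -> linspan P x.
Proof. by move=> Px S _ _; apply. Qed.

Lemma linspan0 P : linspan P 0.
Proof. by move=> S. Qed.

Lemma linspanP P a u v : linspan P u -> linspan P v -> linspan P (a *: u + v).
Proof. by move=> Pu Pv S S0 SD PS; apply: (SD); [apply: Pu|apply: Pv]. Qed.

Lemma linspanZ P a u : linspan P u -> linspan P (a *: u).
Proof. by move=> Pu; rewrite -[_ *: _]addr0; apply: linspanP => //; apply: linspan0. Qed.

Lemma linspan_sum P (I : Type) (r : seq I) (Q : pred I) (f : I -> V) :
  (forall i, Q i -> linspan P (f i)) -> linspan P (\sum_(i <- r | Q i) f i).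
Proof.
move=> Pf; apply: big_ind => // u v Pu Pv.
by rewrite -[u]scale1r; apply: linspanP.
Qed.

Lemma linspan_trans P Q y :
  linspan P y -> (forall x, P x -> linspan Q x) -> linspan Q y.
Proof. by move=> Py PQ; apply: (Py (linspan Q)) => // *; apply: linspanP. Qed.

Lemma linspan_family n (e : 'I_n -> V) y : linspan [set e i | i in setT] y ->
  exists c : 'I_n -> K, y = \sum_i c i *: e i.
Proof.
move=> ey; apply: (ey (fun y => exists c : 'I_n -> K, y = _))
  => [|a u v [c ->] [d ->]|_ [i _ <-]].
- by exists (fun=> 0); rewrite big1// => i _; rewrite scale0r.
- exists (fun i => a * c i + d i); rewrite scaler_sumr -big_split/=.
  by apply: eq_bigr => i _; rewrite scalerDl scalerA.
- exists (fun j => (j == i)%:R); rewrite (bigD1 i)//= eqxx scale1r big1 ?addr0//.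
  by move=> j /negPf ->; rewrite scale0r.
Qed.

End LinearAlgebra.

Lemma base_expansion_inj B n (f g : nat -> nat) :
  (forall i, (i < n)%N -> (f i < B)%N) -> (forall i, (i < n)%N -> (g i < B)%N) ->
  (\sum_(i < n) f i * B ^ i = \sum_(i < n) g i * B ^ i)%N ->
  forall i, (i < n)%N -> f i = g i.
Proof.
elim: n f g => // n IHn f g fB gB.
rewrite !big_ord_recl !expn0 !muln1.
have shift (h : nat -> nat) : (\sum_(i < n) h (lift ord0 i) * B ^ lift ord0 i =
    (\sum_(i < n) h i.+1 * B ^ i) * B)%N.
  by rewrite big_distrl/=; apply: eq_bigr => i _; rewrite expnS mulnCA mulnC.
rewrite !shift => E.
have B0 : (0 < B)%N by apply: leq_trans (fB 0%N _).
have E0 : f 0%N = g 0%N.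
  by have := congr1 (modn^~ B) E; rewrite ![(_ + _ * B)%N]addnC
    !modnMDl !modn_small ?fB ?gB.
case=> [//|i] ni; apply: (IHn (fun i => f i.+1) (fun i => g i.+1)) => // [j jn|j jn|].
- by apply: fB.
- by apply: gB.
by apply/eqP; rewrite -(eqn_pmul2r B0) -(eqn_add2l (f 0%N)) {2}E0 E.
Qed.

(** * Standard monomials *)

Section StandardMonomials.
Variables (K : fieldType) (R : comAlgType K) (n : nat) (s : 'I_n -> R).
Variable B : nat.
Implicit Types (m : {ffun 'I_n -> nat}) (v : 'I_n) (d : nat).

Definition eval m : R := \prod_v s v ^+ m v.

(* The exponent vector read in base [B], hence a total order on the monomials of
   degree less than [B]; it is additive, hence compatible with multiplication. *)
Definition weight m := (\sum_v m v * B ^ v)%N.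

(** This makes [m] the strictly heaviest monomial of a homogeneous relation among the [s v]:
    reducible monomials play the role of an initial ideal. *)
Definition reducible m := linspan
  [set y | exists m', [/\ mdeg m' = mdeg m, (weight m' < weight m)%N & y = eval m']]
  (eval m).

Definition monomials d : seq {ffun 'I_n -> nat} :=
  [seq m <- [seq [ffun v => nat_of_ord (f v)] | f : {ffun 'I_n -> 'I_d.+1}]
  | mdeg m == d].

Definition standard d := [seq m <- monomials d | `[< ~ reducible m >]].

Lemma eval_mulX m v : eval (mulX m v) = s v * eval m.
Proof.
rewrite /eval (bigD1 v)//= [in RHS](bigD1 v)//= ffunE eqxx addn1 exprS -mulrA.
by congr (_ * (_ * _)); apply: eq_bigr => w /negPf wv; rewrite ffunE wv addn0.
Qed.

Lemma weight_mulX m v : weight (mulX m v) = (weight m + B ^ v)%N.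
Proof.
rewrite /weight; under eq_bigr do rewrite ffunE mulnDl.
rewrite big_split/=; congr addn; rewrite (bigD1 v)//= eqxx mul1n big1 ?addn0//.
by move=> w /negPf ->.
Qed.

Lemma exponent_le m v : (m v <= mdeg m)%N.
Proof. by rewrite /mdeg (bigD1 v)//= leq_addr. Qed.

(** Every exponent is at most the degree, hence a genuine digit in base [B]. *)
Lemma weight_inj m m' : (mdeg m < B)%N -> (mdeg m' < B)%N ->
  weight m = weight m' -> m = m'.
Proof.
move=> mB mB' E; apply/ffunP => v.
pose f (p : {ffun 'I_n -> nat}) i := if insub i is Some v then p v else 0%N.
have fE p (w : 'I_n) : f p w = p w by rewrite /f valK.
have fB p i : (mdeg p < B)%N -> (f p i < B)%N.
  rewrite /f; case: insubP => [u _ _|_]; last exact: leq_ltn_trans.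
  exact/leq_ltn_trans/exponent_le.
rewrite -!fE; apply: (@base_expansion_inj B n) => // [i _|i _|]; try exact: fB.
by under eq_bigr do rewrite fE; under [RHS]eq_bigr do rewrite fE.
Qed.

Lemma mem_monomials d m : (m \in monomials d) = (mdeg m == d).
Proof.
rewrite mem_filter; case: eqP => //= md; apply/mapP.
exists [ffun v => inord (m v)]; first by rewrite mem_enum.
by apply/ffunP => v; rewrite !ffunE inordK// ltnS -md exponent_le.
Qed.

Lemma uniq_monomials d : uniq (monomials d).
Proof.
rewrite filter_uniq// map_inj_uniq ?enum_uniq// => f g /ffunP E.
by apply/ffunP => v; apply/val_inj; have := E v; rewrite !ffunE.
Qed.

Lemma uniq_standard d : uniq (standard d).
Proof. exact/filter_uniq/uniq_monomials. Qed.

Lemma mem_standard d m :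
  m \in standard d <-> mdeg m = d /\ ~ reducible m.
Proof.
rewrite mem_filter mem_monomials; split=> [/andP[/asboolP ? /eqP ?]//|[-> ?]].
by rewrite eqxx andbT; apply/asboolP.
Qed.

(** Multiplying a reduction of [divX m v] by [s v] would reduce [m]: all weights shift by the same
    [B ^ v] and all degrees by one. *)
Lemma standard_shadow d : shadow_in (standard d.+1) (standard d).
Proof.
move=> m v /mem_standard[md mred] mv; apply/mem_standard; split.
  by apply: succn_inj; rewrite -mdeg_divX.
move=> red; apply: mred; rewrite /reducible.
set P := [set y | _]%classic; rewrite -(divXK mv) eval_mulX.
apply: (red (fun y => linspan P (s v * y))).
- by rewrite mulr0; apply: linspan0.
- by move=> a y z Py Pz; rewrite mulrDr -scalerAr; apply: linspanP.
- move=> _ [m' [m'd m'w ->]]; rewrite -eval_mulX; apply: linspan_sub.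
  exists (mulX m' v); split => //; first by rewrite mdeg_mulX m'd -mdeg_divX.
  by rewrite -(divXK mv) !weight_mulX ltn_add2r.
Qed.

(** Strong induction on the weight: a reducible monomial is replaced by lighter ones of the same
    degree. *)
Lemma eval_standard m :
  linspan [set eval m' | m' in [set` standard (mdeg m)]] (eval m).
Proof.
have [w] := ubnP (weight m); elim: w m => // w IHw m mw.
have [red|nred] := pselect (reducible m); last first.
  by apply: linspan_sub; exists m => //=; apply/mem_standard.
apply: linspan_trans red _ => _ [m' [<- m'w ->]]; apply: IHw.
exact: leq_trans m'w mw.
Qed.

(** If some coefficient were nonzero, solving for the heaviest monomial that occurs would make it
    reducible; [d < B] excludes ties of weight. *)
Lemma eval_free d (c : 'I_(size (standard d)) -> K) : (d < B)%N ->
  \sum_i c i *: eval (nth [ffun=> 0%N] (standard d) i) = 0 -> forall i, c i = 0.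
Proof.
move=> dB c0 i; apply/eqP/negPn/negP => ci.
pose st i := nth [ffun=> 0%N] (standard d) i.
have stP (j : 'I_(size (standard d))) : mdeg (st j) = d /\ ~ reducible (st j).
  by apply/mem_standard/mem_nth.
case: (@arg_maxnP _ i (fun i => c i != 0) (fun i => weight (st i)) ci) => k ck kmax.
have [kd +] := stP k; apply; rewrite /reducible; set P := [set y | _]%classic.
move: c0; rewrite (bigD1 k)//= => /eqP; rewrite addr_eq0 => /eqP ckE.
have -> : eval (st k) = (- (c k)^-1) *: (\sum_(j < _ | j != k) c j *: eval (st j)).
  by rewrite scaleNr -scalerN -ckE scalerA mulVf// scale1r.
apply: linspanZ; apply: linspan_sum => j jk.
have [->|cj] := eqVneq (c j) 0; first by rewrite scale0r; apply: linspan0.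
apply: linspanZ; apply: linspan_sub; exists (st j); split=> //; have [jd _] := stP j.
  by rewrite jd kd.
rewrite ltn_neqAle [X in _ && X]kmax// andbT; apply/eqP => /weight_inj.
rewrite jd kd => /(_ dB dB)/eqP.
by rewrite nth_uniq ?uniq_standard// => /eqP/val_inj/eqP; rewrite (negPf jk).
Qed.

End StandardMonomials.

(** * Hilbert functions of standard graded algebras *)

Section GradedAlgebra.
Variables (K : fieldType) (R : comAlgType K) (A : nat -> set R).
Hypothesis hA : standard_graded A.
Variables (n : nat) (s : 'I_n -> R).
Hypothesis s1 : forall v, A 1%N (s v).
Hypothesis sgen : forall S : set R, subalg_closed (mem S) ->
  (forall v, S (s v)) -> S = setT.
Implicit Types (m : {ffun 'I_n -> nat}) (d B : nat).

Lemma graded_zero d : A d 0.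
Proof. by have [+ _] := graded_submod hA d; rewrite inE. Qed.

Lemma graded_linear d a x y : A d x -> A d y -> A d (a *: x + y).
Proof.
move=> Ax Ay; have [_ /(_ a x y)] := graded_submod hA d.
by rewrite !inE; apply.
Qed.

Lemma graded_one : A 0%N 1.
Proof. by rewrite (graded0 hA); exists 1 => //; rewrite scale1r. Qed.

Lemma eval_graded m : A (mdeg m) (eval s m).
Proof.
rewrite /mdeg /eval; elim/big_ind2 : _ => [|d x e y Ax Ay|v _].
- exact: graded_one.
- exact: (gradedM hA).
elim: (m v) => [|k IHk]; first by rewrite expr0; apply: graded_one.
by rewrite exprS -add1n; apply: (gradedM hA).
Qed.

Lemma eval_mul m m' : eval s [ffun v => (m v + m' v)%N] = eval s m * eval s m'.
Proof. by rewrite /eval -big_split/=; apply: eq_bigr => v _; rewrite ffunE exprD. Qed.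

(** The span of the monomials is a subalgebra containing the generators; closure under products
    follows by span induction on each factor in turn. *)
Lemma linspan_eval y : linspan (range (eval s)) y.
Proof.
suff -> : linspan (range (eval s)) = setT by [].
apply: sgen => [|v]; last first.
  apply: linspan_sub; exists (mulX [ffun=> 0%N] v) => //.
  by rewrite eval_mulX /eval big1 ?mulr1// => w _; rewrite ffunE.
split.
- rewrite inE; apply: linspan_sub; exists [ffun=> 0%N] => //.
  by rewrite /eval big1// => w _; rewrite ffunE.
- by move=> a u w; rewrite !inE; apply: linspanP.
- move=> u w; rewrite !inE => Pu Pw.
  apply: (Pu (fun u => linspan (range (eval s)) (u * w))).
  + by rewrite mul0r; apply: linspan0.
  + by move=> a u1 u2 P1 P2; rewrite mulrDl -scalerAl; apply: linspanP.
  + move=> _ [m _ <-].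
    apply: (Pw (fun w => linspan (range (eval s)) (eval s m * w))).
    * by rewrite mulr0; apply: linspan0.
    * by move=> a u1 u2 P1 P2; rewrite mulrDr -scalerAr; apply: linspanP.
    * move=> _ [m' _ <-]; rewrite -eval_mul; apply: linspan_sub.
      by exists [ffun v => (m v + m' v)%N].
Qed.

(** Group an expansion of [y] in monomials by degree; directness of the grading identifies [y] with
    the component of degree [d]. *)
Lemma graded_linspan d y : A d y ->
  linspan [set eval s m | m in [set m | mdeg m = d]] y.
Proof.
move=> Ay; pose T d := linspan [set eval s m | m in [set m | mdeg m = d]].
have TA e z : T e z -> A e z.
  apply; [exact: graded_zero|move=> *; exact: graded_linear|].
  by move=> _ [m <- <-]; apply: eval_graded.
(* [f i] collects the terms of degree [i]. Allowing every [q] from [p] on lets two expansions be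
   added over a common range. *)
have [p [f [fT fE]]] : exists p f, (forall i, T i (f i)) /\
    forall q, (p <= q)%N -> y = \sum_(i < q) f i.
  apply: (@linspan_eval y (fun y => exists p f, (forall i, T i (f i)) /\
    forall q, (p <= q)%N -> y = \sum_(i < q) f i)).
  - exists 0%N, (fun=> 0); split=> [i|q _]; first exact: linspan0.
    by rewrite big1.
  - move=> a u w [p1 [f1 [f1T f1E]]] [p2 [f2 [f2T f2E]]].
    exists (maxn p1 p2), (fun i => a *: f1 i + f2 i); split=> [i|q].
      by apply: linspanP; [apply: f1T|apply: f2T].
    by rewrite geq_max => /andP[/f1E -> /f2E ->]; rewrite big_split/= scaler_sumr.
  - move=> _ [m _ <-]; exists (mdeg m).+1, (fun i => if i == mdeg m then eval s m else 0).
    split=> [i|q mq].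
      by case: eqP => [->|_]; [apply: linspan_sub; exists m|apply: linspan0].
    rewrite (bigD1 (Ordinal mq))//= eqxx big1 ?addr0// => i /negPf im.
    by rewrite -(inj_eq val_inj) /= in im; rewrite im.
pose q := maxn p d.+1; have dq : (d < q)%N by rewrite leq_max leqnn orbT.
suff -> : y = f d by apply: fT.
apply/eqP; rewrite -subr_eq0 -opprB oppr_eq0; apply/eqP.
(* Subtracting [y] from the component of degree [d] leaves a vanishing sum of homogeneous
   elements. *)
have := @graded_direct _ _ _ hA q (fun i => f i - (if i == d then y else 0)) _ _ d dq.
rewrite eqxx; apply=> [i|].
  case: eqP => [->|_]; rewrite addrC -?scaleN1r; last by rewrite scaler0 add0r; apply: TA.
  by apply: graded_linear => //; apply: TA.
rewrite sumrB -(fE q) ?leq_maxl// [X in _ - X](bigD1 (Ordinal dq))//= eqxx.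
rewrite big1 ?addr0 ?subrr// => i /negPf im.
by rewrite -(inj_eq val_inj) /= in im; rewrite im.
Qed.

Lemma standard_basis B d : (d < B)%N ->
  is_basis (A d) (fun i : 'I_(size (standard s B d)) =>
    eval s (nth [ffun=> 0%N] (standard s B d) i)).
Proof.
move=> dB; split=> [i|c|y].
- have /mem_standard[id _] := mem_nth [ffun=> 0%N] (ltn_ord i).
  by rewrite -[X in A X]id; apply: eval_graded.
- exact: eval_free.
move=> /graded_linspan yd; apply: linspan_family; apply: linspan_trans yd _.
move=> _ [m <- <-]; apply: (linspan_trans (@eval_standard _ _ _ s B m)).
move=> _ [m' /= m'm <-]; apply: linspan_sub.
have im : (index m' (standard s B (mdeg m)) < size (standard s B (mdeg m)))%N.
  by rewrite index_mem.
by exists (Ordinal im) => //=; rewrite nth_index.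
Qed.

Lemma hilbert_functionE B d : (d < B)%N -> hilbert_function A d = size (standard s B d).
Proof. by move=> dB; apply: dimensionE (standard_basis dB). Qed.

End GradedAlgebra.

Section Hilbert.
Variables (K : fieldType) (R : comAlgType K) (A : nat -> set R).
Hypothesis hA : standard_graded A.

Lemma hilbert_function0 : hilbert_function A 0 = 1%N.
Proof.
apply: (@dimensionE _ _ _ _ (fun _ : 'I_1 => 1)); split=> [_|c|y].
- exact: graded_one.
- rewrite big_ord1 => /eqP; rewrite scaler_eq0 oner_eq0 orbF => /eqP c0 i.
  by rewrite ord1.
- by rewrite (graded0 hA) => -[a _ <-]; exists (fun=> a); rewrite big_ord1.
Qed.

Lemma hilbert_function_growth (F : realType) r (x : F) : r%:R <= x ->
  (hilbert_function A r.+1)%:R = gbinomial x r.+1 ->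
  (hilbert_function A r.+2)%:R <= gbinomial (x + 1) r.+2.
Proof.
move=> rx; have [l [l1 lgen]] := graded_gen hA.
pose s (i : 'I_(size l)) := l`_i.
have s1 v : A 1%N (s v) by apply/l1/mem_nth.
have sgen (S : set R) : subalg_closed (mem S) -> (forall v, S (s v)) -> S = setT.
  move=> Ssub Ss; apply: lgen => // _ /(nthP 0)[i il <-].
  exact: (Ss (Ordinal il)).
(* The base [r.+3] exceeds both degrees r+1 and r+2, so that a single monomial order serves both. *)
rewrite !(hilbert_functionE hA s1 sgen (B := r.+3))//.
apply: shadow_bound rx; try exact: uniq_standard.
- by move=> m /mem_standard[].
- by move=> m /mem_standard[].
- exact: standard_shadow.
Qed.

End Hilbert.

Theorem theorem5p10 (K : fieldType) (R : comAlgType K) (A : nat -> set R)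
    (hA : standard_graded A) (F : realType) (r : nat) (hr : (1 <= r)%N)
    (x : F) (hx : r%:R - 1 <= x)
    (hhr : (hilbert_function A r)%:R = gbinomial x r) :
  gbinomial (x - 1) r.-1 <= (hilbert_function A r.-1)%:R /\
  (hilbert_function A r.+1)%:R <= gbinomial (x + 1) r.+1.
Proof.
case: r hr hx hhr => // r _; rewrite -natr1 addrK => rx hr /=.
split; last exact: hilbert_function_growth.
case: r rx hr => [|r] rx hr; first by rewrite gbinomial0 hilbert_function0.
(* Now [r] is two less than in the statement. If h_(r+1) = binom(y,r+1) were below binom(x-1,r+1),
   then y+1 < x, and growth from y would give h_(r+2) <= binom(y+1,r+2) < binom(x,r+2) = h_(r+2). *)
have [y ry yE] := gbinomial_surj r (ler0n F (hilbert_function A r.+1)).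
rewrite leNgt; apply/negP => hlt.
have yx : y < x - 1.
  rewrite ltNge; apply/negP => xy; move: hlt; rewrite -yE ltNge ler_gbinomial//.
  by rewrite lerBrDr natr1.
have := hilbert_function_growth hA ry (esym yE); rewrite hr leNgt.
by rewrite ltr_gbinomial -?ltrBrDr// -natr1 lerD2r.
Qed.
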